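(* Let $\mathbb{K}$ be a nonzero commutative ring. If $G$ is a finite digraph and $\ell\ge1$ is an integer such that $\mathrm{MH}_{2,k}(G,\mathbb{K})=0$ for all $k>\ell$, then the $\ell$-fundamental category $\tau^\ell(G)$ is thin, i.e. each of its hom-sets has cardinality at most one.
   Context: A digraph $G$ consists of a set of vertices and a set of arrows, which are ordered pairs of distinct vertices. A path of length $n\ge 0$ is a tuple of vertices $(p_0,\dots,p_n)$ such that each $(p_i,p_{i+1})$ is an arrow; $d(x,y)$ is the infimum of lengths of paths from $x$ to $y$ ($\infty$ if there are none). Put $|x_0,\dots,x_n|=\sum_{i=0}^{n-1}d(x_i,x_{i+1})$. Magnitude homology: $\mathrm{MC}_{n,\ell}(G,\mathbb{K})$ is the free $\mathbb{K}$-module on tuples of vertices with $x_i\neq x_{i+1}$ and $|x_0,\dots,x_n|=\ell$; the differential is $\sum_{i=0}^n(-1)^i\partial_{n,i}$, where $\partial_{n,i}$ deletes $x_i$ if the resulting tuple still has norm $\ell$ and is $0$ otherwise. $\mathrm{MH}_{n,\ell}(G,\mathbb{K})=H_n(\mathrm{MC}_{\bullet,\ell}(G,\mathbb{K}))$. $\mathscr{N}^\ell(G)$ is the simplicial set whose $n$-simplices are the tuples of vertices $(x_0,\dots,x_n)$ (repetitions allowed) with $|x_0,\dots,x_n|\le\ell$; face maps delete a vertex and degeneracy maps double a vertex. The fundamental category functor $\tau:\mathsf{sSets}\to\mathsf{Cat}$ is the left adjoint of the nerve functor; explicitly, $\tau(X)$ is the quotient of the free path category on the $1$-skeleton of $X$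 (viewed as a quiver) by the relations $\partial_0t\circ\partial_2t=\partial_1t$ for $2$-simplices $t$ and $\sigma_0x=1_x$ for $0$-simplices $x$. The $\ell$-fundamental category is $\tau^\ell(G)=\tau(\mathscr{N}^\ell(G))$. *)

(* Defs.v *)
From HB Require Import structures.
From mathcomp Require Import all_boot all_order all_algebra.
From mathcomp Require Import boolp constructive_ereal zify.

Set Implicit Arguments.
Unset Strict Implicit.
Unset Printing Implicit Defensive.

Import Order.TTheory GRing.Theory Num.Theory.
Local Open Scope ring_scope.

Record finDigraph := FinDigraph {
  vertex :> finType;
  arrow : rel vertex;
  arrow_irr : irreflexive arrow
}.

Section Distance.
Variable G : finDigraph.

Definition walk (n : nat) (x y : G) : bool :=
  [exists p : n.-tuple G, path (@arrow G) x p && (last x p == y)].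

(* Distances live in [\bar int]; only natural numbers and [+oo] occur. *)
Definition dist (x y : G) : \bar int :=
  if pselect (exists n, walk n x y) is left ex_walk
  then ((ex_minn ex_walk)%:Z)%:E else +oo%E.

Definition norm (n : nat) (x : n.+1.-tuple G) : \bar int :=
  (\sum_(i < n) dist (tnth x (widen_ord (leqnSn n) i))
                     (tnth x (lift ord0 i)))%E.

Lemma walkP n x y :
  reflect (exists p, [/\ size p = n, path (@arrow G) x p & last x p = y])
          (walk n x y).
Proof.
apply: (iffP existsP) => [[p /andP[xp /eqP yp]]|[p [sp xp yp]]].
  by exists p; rewrite size_tuple.
have sp' : size p == n by apply/eqP.
by exists (Tuple sp'); rewrite /= xp yp eqxx.
Qed.

Lemma dist_walk n x y : walk n x y -> (dist x y <= (n%:Z)%:E)%E.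
Proof.
move=> w; rewrite /dist; case: pselect => [h|[]]; last by exists n.
by case: ex_minnP => m _ /(_ _ w) mn; rewrite lee_fin lez_nat.
Qed.

Variant dist_spec x y : \bar int -> Prop :=
  | DistFin n of walk n x y & (forall m, walk m x y -> (n <= m)%N) :
      dist_spec x y (n%:Z)%:E
  | DistInf of (forall n, ~~ walk n x y) : dist_spec x y +oo%E.

Lemma distP x y : dist_spec x y (dist x y).
Proof.
rewrite /dist; case: pselect => [h|h].
  by case: ex_minnP => m wm min_m; constructor.
by constructor=> n; apply/negP => w; apply: h; exists n.
Qed.

Lemma dist_ge0 x y : (0 <= dist x y)%E.
Proof. by case: distP => // n *; rewrite lee_fin. Qed.

Lemma distxx x : dist x x = 0%E.
Proof.
apply/eqP; rewrite eq_le dist_ge0 andbT; apply: (@dist_walk 0).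
by apply/walkP; exists [::].
Qed.

Lemma dist_eq0 x y : dist x y = 0%E -> x = y.
Proof.
case: distP => [n xy _ [n0]|//]; move: xy; rewrite n0.
by case/walkP => p [/size0nil -> _ <-].
Qed.

Lemma dist_triangle y x z : (dist x z <= dist x y + dist y z)%E.
Proof.
case: (distP x y) => [m|_]; last first.
  by rewrite addye ?leey //; case: distP.
move=> /walkP[p [sp xp yp]] _.
case: (distP y z) => [n|_]; last by rewrite addey // leey.
move=> /walkP[q [sq yq zq]] _; rewrite -EFinD -PoszD; apply: dist_walk.
by apply/walkP; exists (p ++ q); rewrite size_cat cat_path last_cat sp sq yp xp.
Qed.

Definition del (n : nat) (i : 'I_n.+2) (x : n.+2.-tuple G) : n.+1.-tuple G :=
  [tuple tnth x (lift i j) | j < n.+1].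

Fact unbump_ltn (n : nat) (i : 'I_n.+1) (j : 'I_n.+2) : (unbump i j < n.+1)%N.
Proof. by rewrite /unbump; case: i j => i ? [j ?] /=; case: ltnP => /=; lia. Qed.

Definition dbl (n : nat) (i : 'I_n.+1) (x : n.+1.-tuple G) : n.+2.-tuple G :=
  [tuple tnth x (Ordinal (unbump_ltn i j)) | j < n.+2].

Let N (f : nat -> G) n : \bar int := (\sum_(i < n) dist (f i) (f i.+1))%E.

Let NS f n : N f n.+1 = (dist (f 0%N) (f 1%N) + N (f \o succn) n)%E.
Proof. by rewrite /N big_ord_recl. Qed.

Let eqN f g n : (forall i, i <= n -> f i = g i)%N -> N f n = N g n.
Proof. by move=> fg; apply: eq_bigr => i _; rewrite !fg // ltnW. Qed.

Let N_ge0 f n : (0 <= N f n)%E.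
Proof. by apply: sume_ge0 => i _; apply: dist_ge0. Qed.

Let normE n (x : n.+1.-tuple G) : norm x = N (fun j => tnth x (inord j)) n.
Proof.
apply: eq_bigr => i _; congr (dist (tnth x _) (tnth x _)); apply: val_inj.
  by rewrite /= inordK // ltnW // ltnS.
by rewrite /= inordK // ltnS.
Qed.

Let N_bump f i n : (N (f \o bump i) n <= N f n.+1)%E.
Proof.
elim: n f i => [|n IH] f [|i].
- by rewrite /N big_ord0 -/(N f 1) N_ge0.
- by rewrite /N big_ord0 -/(N f 1) N_ge0.
- by rewrite (NS f) -[leLHS]add0e leeD ?dist_ge0.
have bS j : bump i.+1 j.+1 = (bump i j).+1 by rewrite /bump ltnS addnS.
case: i => [|i] in bS *; last first.
  rewrite NS (NS f) /= leeD //.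
  rewrite (@eqN _ ((f \o succn) \o bump i.+1)) ?IH // => j _.
  by rewrite /= bS.
rewrite NS (NS f) (NS (f \o succn)) addeA leeD //=.
exact: dist_triangle.
Qed.

Let N_unbump f i n : (i <= n)%N -> N (f \o unbump i) n.+1 = N f n.
Proof.
elim: n f i => [|n IH] f [|i] //= lein.
- by rewrite NS /= distxx add0e; apply: eqN => j; rewrite leqn0 => /eqP ->.
- rewrite NS /= distxx add0e; apply: eqN => j _.
  by rewrite /= /unbump subn1.
rewrite NS (NS f) -(IH (f \o succn) i) //; congr (_ + _)%E.
apply: eqN => j _; rewrite /= /unbump ltnS; congr (f _).
by case: ltnP => /= ?; lia.
Qed.

Lemma norm_del n (i : 'I_n.+2) (x : n.+2.-tuple G) : (norm (del i x) <= norm x)%E.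
Proof.
rewrite !normE (@eqN _ ((fun j => tnth x (inord j)) \o bump i)) ?N_bump // => j jn.
rewrite tnth_mktuple; congr tnth; apply: val_inj => /=.
by rewrite !inordK // /bump; case: leqP => /=; lia.
Qed.

Lemma norm_dbl n (i : 'I_n.+1) (x : n.+1.-tuple G) : norm (dbl i x) = norm x.
Proof.
rewrite !normE -(@N_unbump _ i n) ?leq_ord //; apply: eqN => j jn.
rewrite tnth_mktuple; congr tnth; apply: val_inj => /=.
rewrite !inordK //; case: i => i /= ? /=; rewrite /unbump.
by case: ltnP => /=; lia.
Qed.

Definition reduced (n : nat) (x : n.+1.-tuple G) : bool :=
  [forall i : 'I_n, tnth x (widen_ord (leqnSn n) i) != tnth x (lift ord0 i)].

Let reducedP n (x : n.+1.-tuple G) :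
  reflect (forall k, k < n -> tnth x (inord k) != tnth x (inord k.+1))%N
          (reduced x).
Proof.
apply: (iffP forallP) => [xr k kn|xr i].
  have := xr (Ordinal kn).
  by congr (tnth x _ != tnth x _); apply: val_inj; rewrite /= inordK // ltnW.
have := xr i (ltn_ord i).
congr (tnth x _ != tnth x _); apply: val_inj; rewrite /= inordK //.
- by rewrite ltnS ltnW.
- by rewrite ltnS.
Qed.

Let N_bump_reduced f i n : N f n.+1 \is a fin_num ->
  N (f \o bump i) n = N f n.+1 ->
  (forall k, k < n.+1 -> f k != f k.+1)%N ->
  (forall k, k < n -> f (bump i k) != f (bump i k.+1))%N.
Proof.
elim: n f i => [|n IH] f [|i] fin_f Nf fr k //.
  by move=> kn; apply: fr.
have bS j : bump i.+1 j.+1 = (bump i j).+1 by rewrite /bump ltnS addnS.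
have fin_d : dist (f 0%N) (f 1%N) \is a fin_num.
  by move: fin_f; rewrite (NS f) fin_numD => /andP[].
have fin_f1 : N (f \o succn) n.+1 \is a fin_num.
  by move: fin_f; rewrite (NS f) fin_numD => /andP[].
case: i => [|i] in bS Nf *.
  case: k => [_|k kn]; last by apply: fr; rewrite ltnS.
  apply/negP => /eqP f02; move: Nf; rewrite NS /= f02 distxx add0e.
  have := fin_f1; rewrite (NS f) (NS (f \o succn)) fin_numD.
  rewrite (@eqN _ ((f \o succn) \o succn)) // => /andP[fin_d1 fin_f2].
  rewrite addeA -[LHS]add0e => /(congr1 (fun z => z - N ((f \o succn) \o succn) n)%E).
  rewrite !addeK // => d0.
  have /dist_eq0 f01 : dist (f 0%N) (f 1%N) = 0%E.
    apply/eqP; rewrite eq_le dist_ge0 andbT.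
    by rewrite [leRHS]d0 leeDl // dist_ge0.
  by have := fr 0%N isT; rewrite f01 eqxx.
case: k => [_|k]; first exact: fr.
rewrite ltnS !bS => kn.
apply: (IH (f \o succn) i.+1) => //; last by move=> j jn; apply: fr.
move: Nf; rewrite NS (NS f) /=.
rewrite (@eqN _ ((f \o succn) \o bump i.+1)); last by move=> j _; rewrite /= bS.
move=> /(congr1 (fun z => z - dist (f 0%N) (f 1%N))%E).
by rewrite ![(dist _ _ + _)%E]addeC !addeK.
Qed.

Lemma reduced_del n (l : nat) (i : 'I_n.+2) (x : n.+2.-tuple G) :
  reduced x -> norm x = (l%:Z)%:E -> norm (del i x) = (l%:Z)%:E ->
  reduced (del i x).
Proof.
move=> /reducedP xr xl dl.
have delE j : (j < n.+1)%N -> tnth (del i x) (inord j) = tnth x (inord (bump i j)).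
  move=> jn; rewrite tnth_mktuple; congr tnth; apply: val_inj => /=.
  by rewrite !inordK // /bump; case: leqP => /=; lia.
apply/reducedP => k kn; rewrite !delE ?ltnS //; last exact: ltnW.
apply: (@N_bump_reduced (fun j => tnth x (inord j)) i n) => //.
  by rewrite -normE xl.
rewrite -normE xl -dl normE; apply: eqN => j jn.
by rewrite delE.
Qed.

End Distance.

Definition mc_gen (G : finDigraph) (n l : nat) : Type :=
  {x : n.+1.-tuple G | reduced x && (norm x == (l%:Z)%:E)}.
HB.instance Definition _ (G : finDigraph) n l :=
  SubType.copy (mc_gen G n l)
    {x : n.+1.-tuple G | reduced x && (norm x == (l%:Z)%:E)}.
HB.instance Definition _ (G : finDigraph) n l :=
  Finite.copy (mc_gen G n l)
    {x : n.+1.-tuple G | reduced x && (norm x == (l%:Z)%:E)}.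

Section MagnitudeHomology.
Variables (G : finDigraph) (K : comNzRingType).
Implicit Types n l : nat.

Definition MC n l := {ffun mc_gen G n l -> K^o}.
HB.instance Definition _ n l :=
  GRing.Lmodule.copy (MC n l) {ffun mc_gen G n l -> K^o}.

Definition mc_basis n l (x : mc_gen G n l) : MC n l :=
  [ffun y => (y == x)%:R].

(* For x a face of a generator of norm l, this vanishes exactly when the norm of
   x differs from l: see [reduced_del], [mc_face_gen] and [mc_face_eq0]. *)
Definition mc_tuple n l (x : n.+1.-tuple G) : MC n l :=
  if insub x is Some y then mc_basis (y : mc_gen G n l) else 0.

Definition mc_face n l (i : 'I_n.+2) (x : mc_gen G n.+1 l) : MC n l :=
  mc_tuple l (del i (val x)).

Lemma mc_faceE n l (i : 'I_n.+2) (x : mc_gen G n.+1 l) (y : mc_gen G n l) :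
  mc_face i x y = (del i (val x) == val y)%:R.
Proof.
rewrite /mc_face /mc_tuple; case: insubP => [z _ zE|].
  by rewrite ffunE -zE eq_sym (inj_eq val_inj).
move=> /negP nx; rewrite ffunE; have [xy|//] := eqVneq; case: nx.
by rewrite xy; apply: (valP y).
Qed.

Lemma mc_face_gen n l (i : 'I_n.+2) (x : mc_gen G n.+1 l) :
  norm (del i (val x)) = (l%:Z)%:E ->
  exists2 y : mc_gen G n l, val y = del i (val x) & mc_face i x = mc_basis y.
Proof.
move=> dl; have /andP[xr /eqP xl] := valP x.
have dP : reduced (del i (val x)) && (norm (del i (val x)) == (l%:Z)%:E).
  by rewrite dl eqxx andbT (reduced_del xr xl dl).
rewrite /mc_face /mc_tuple; case: insubP => [y _ yE|/negP//].
by exists y.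
Qed.

Lemma mc_face_eq0 n l (i : 'I_n.+2) (x : mc_gen G n.+1 l) :
  norm (del i (val x)) <> (l%:Z)%:E -> mc_face i x = 0.
Proof.
move=> dl; rewrite /mc_face /mc_tuple; case: insubP => // y /andP[_ /eqP].
by [].
Qed.

Definition mc_diff n l (c : MC n.+1 l) : MC n l :=
  \sum_x c x *: \sum_(i < n.+2) (-1) ^+ i *: mc_face i x.

Lemma mc_diff_is_linear n l : linear (@mc_diff n l).
Proof.
move=> a c d; rewrite /mc_diff scaler_sumr -big_split /=; apply: eq_bigr => x _.
by rewrite !ffunE scalerDl scalerA.
Qed.
HB.instance Definition _ n l :=
  GRing.isLinear.Build K (MC n.+1 l) (MC n l) _ (@mc_diff n l)
    (@mc_diff_is_linear n l).

Lemma mc_diff_basis n l (x : mc_gen G n.+1 l) :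
  mc_diff (mc_basis x) = \sum_(i < n.+2) (-1) ^+ i *: mc_face i x.
Proof.
rewrite /mc_diff (bigD1 x) //= ffunE eqxx scale1r [X in _ + X]big1 ?addr0 // => y yx.
by rewrite ffunE (negbTE yx) scale0r.
Qed.

Let diff_face n l (i : 'I_n.+3) (x : mc_gen G n.+2 l) :
  mc_diff (mc_face i x) =
  \sum_(j < n.+2) (-1) ^+ j *: mc_tuple l (del j (del i (val x))).
Proof.
have /andP[_ /eqP xl] := valP x.
have [dl|/eqP dl] := eqVneq (norm (del i (val x))) (l%:Z)%:E.
  by have [y yE ->] := mc_face_gen dl; rewrite mc_diff_basis -yE.
rewrite mc_face_eq0 // linear0 big1 // => j _.
rewrite /mc_tuple; case: insubP => [y|_]; last by rewrite scaler0.
case/andP=> _ /eqP djl; case: dl; apply/eqP; rewrite eq_le.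
apply/andP; split; first by rewrite (le_trans (norm_del _ _)) ?xl.
by rewrite (le_trans _ (norm_del j _)) ?djl.
Qed.

Lemma del_del n (i : 'I_n.+2) (j : 'I_n.+3) (x : n.+3.-tuple G) : (i < j)%N ->
  forall (i' : 'I_n.+3) (j' : 'I_n.+2), i' = i :> nat -> j = j'.+1 :> nat ->
  del i (del j x) = del j' (del i' x).
Proof.
move=> ij i' j' ii' jj'; apply: eq_from_tnth => k; rewrite !tnth_mktuple.
congr tnth; apply: val_inj => /=; rewrite /bump ii' jj'.
move: ij; rewrite jj' ltnS => ij.
by case: (leqP i k) => /= ?; case: (leqP j' k) => /= ?; rewrite /bump; lia.
Qed.

Lemma mc_diffK n l (c : MC n.+2 l) : mc_diff (mc_diff c) = 0.
Proof.
rewrite [mc_diff c]/mc_diff linear_sum big1 // => x _.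
rewrite linearZ linear_sum /=.
pose F (i : 'I_n.+3) (j : 'I_n.+2) : MC n l :=
  (-1) ^+ (i + j) *: mc_tuple l (del j (del i (val x))).
have -> : \sum_(i < n.+3) mc_diff ((-1) ^+ i *: mc_face i x) =
    \sum_(p : 'I_n.+3 * 'I_n.+2) F p.1 p.2.
  rewrite -(pair_bigA _ F) /=; apply: eq_bigr => i _.
  rewrite linearZ /= diff_face scaler_sumr; apply: eq_bigr => j _.
  by rewrite scalerA -exprD.
rewrite (bigID (fun p : 'I_n.+3 * 'I_n.+2 => (p.2 < p.1)%N)) /=.
pose h (p : 'I_n.+3 * 'I_n.+2) : 'I_n.+3 * 'I_n.+2 :=
  (inord p.2, inord p.1.-1).
pose h' (p : 'I_n.+3 * 'I_n.+2) : 'I_n.+3 * 'I_n.+2 :=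
  (inord p.2.+1, inord p.1).
rewrite [X in _ + X](reindex_onto h h') /=; last first.
  move=> [i j] /=; rewrite -leqNgt => ij; congr (_, _); apply: val_inj => /=.
    by rewrite !inordK //=; move: (ltn_ord i) (ltn_ord j); lia.
  by rewrite !inordK //=; move: (ltn_ord i) (ltn_ord j); lia.
set S1 := \sum_(p | _) _; set S2 := \sum_(p | _) _.
suff -> : S2 = - S1 by rewrite subrr scaler0.
rewrite /S1 /S2 -sumrN; apply: eq_big => [[i j]|[i j]] /=.
  have := ltn_ord i; have := ltn_ord j => ji ii.
  case: (ltnP j i) => ij.
    rewrite !inordK //; try lia.
    rewrite -leqNgt; apply/andP; split; first by lia.
    by apply/eqP; congr (_, _); apply: val_inj; rewrite /= !inordK //; lia.
  apply/negP => /andP[]; rewrite -leqNgt => + /eqP[+ _].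
  by move=> + /(congr1 val) /=; rewrite !inordK //; lia.
rewrite -leqNgt => /andP[+ /eqP[+ _]].
move=> + /(congr1 val) /=; have := ltn_ord i; have := ltn_ord j => ji ii.
rewrite /F /= !inordK //; try lia.
move=> ij iE; rewrite -scaleNr; congr (_ *: mc_tuple l _).
  by rewrite -[in RHS]iE addSn exprS mulN1r addnC opprK.
apply/esym/del_del; first by rewrite -iE ltnS.
  by rewrite /= inordK // ltnW.
by rewrite /= inordK ?iE // -ltnS iE.
Qed.

(* The differential out of degree n; it is zero for n = 0. *)
Definition mc_bd n l : MC n l -> MC n.-1 l :=
  if n is m.+1 then @mc_diff m l else fun _ => 0.

Lemma mc_bd_is_linear n l : linear (@mc_bd n l).
Proof.
case: n => [|n] a c d /=; first by rewrite scaler0 addr0.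
exact: linearP.
Qed.
HB.instance Definition _ n l :=
  GRing.isLinear.Build K (MC n l) (MC n.-1 l) _ (@mc_bd n l)
    (@mc_bd_is_linear n l).

Definition is_cycle n l : {pred MC n l} := fun c => mc_bd c == 0.

Lemma is_cycle_submod n l : submod_closed (@is_cycle n l).
Proof.
split=> [|a c d /eqP c0 /eqP d0]; first by rewrite unfold_in linear0.
by rewrite unfold_in linearP /= c0 d0 scaler0 addr0.
Qed.
HB.instance Definition _ n l :=
  GRing.isSubmodClosed.Build K (MC n l) (@is_cycle n l) (@is_cycle_submod n l).

Record cycle n l := Cycle { cycle_val :> MC n l; _ : cycle_val \in @is_cycle n l }.
HB.instance Definition _ n l := [isSub for @cycle_val n l].
HB.instance Definition _ n l := [Choice of cycle n l by <:].
HB.instance Definition _ n l := [SubChoice_isSubLmodule of cycle n l by <:].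

Definition is_boundary n l : {pred cycle n l} :=
  fun c => `[< exists b : MC n.+1 l, mc_diff b = val c >].

Lemma is_boundary_submod n l : submod_closed (@is_boundary n l).
Proof.
split=> [|a c d /asboolP[b bc] /asboolP[b' bd]]; apply/asboolP.
  by exists 0; rewrite linear0.
by exists (a *: b + b'); rewrite linearP /= bc bd.
Qed.
HB.instance Definition _ n l :=
  GRing.isSubmodClosed.Build K (cycle n l) (@is_boundary n l)
    (@is_boundary_submod n l).

Definition MH n l := Quotient.quot (@is_boundary n l).
HB.instance Definition _ n l := GRing.Zmodule.on (MH n l).

Local Open Scope quotient_scope.

Definition mh_scale n l (a : K) (c : MH n l) : MH n l :=
  \pi_(MH n l) (a *: (repr c : cycle n l)).

Let mh_scale_pi n l a (c : cycle n l) :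
  mh_scale a (\pi_(MH n l) c) = \pi_(MH n l) (a *: c).
Proof.
apply/eqP; rewrite /mh_scale piE Quotient.equivE -scalerBr rpredZ //.
rewrite -Quotient.equivE.
have := reprK (\pi_(MH n l) c).
by move/eqP; rewrite piE.
Qed.

Let mh_scaleA n l a b (c : MH n l) :
  mh_scale a (mh_scale b c) = mh_scale (a * b) c.
Proof. by elim/quotW: c => c; rewrite (mh_scale_pi b) !mh_scale_pi scalerA. Qed.

Let mh_scale1 n l : left_id 1 (@mh_scale n l).
Proof. by elim/quotW=> c; rewrite mh_scale_pi scale1r. Qed.

Let mh_scaleDr n l : right_distributive (@mh_scale n l) +%R.
Proof.
move=> a; elim/quotW=> c; elim/quotW=> d.
by rewrite -raddfD !mh_scale_pi scalerDr raddfD.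
Qed.

Let mh_scaleDl n l (c : MH n l) : {morph (@mh_scale n l)^~ c : a b / a + b}.
Proof. by elim/quotW: c => c a b; rewrite !mh_scale_pi scalerDl raddfD. Qed.

HB.instance Definition _ n l :=
  GRing.Zmodule_isLmodule.Build K (MH n l) (@mh_scaleA n l) (@mh_scale1 n l)
    (@mh_scaleDr n l) (@mh_scaleDl n l).

Lemma mh_eq0 n l :
  (forall c : MH n l, c = 0) <->
  (forall c : MC n l, mc_bd c = 0 -> exists b : MC n.+1 l, mc_diff b = c).
Proof.
split=> [MH0 c /eqP c0|H c].
  have := MH0 (\pi_(MH n l) (@Cycle n l c c0)).
  rewrite -[RHS](raddf0 (\pi_(MH n l))) => /eqP.
  by rewrite piE Quotient.equivE subr0 => /asboolP.
rewrite -[c]reprK -(raddf0 (\pi_(MH n l))); apply/eqP.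
rewrite piE Quotient.equivE subr0; apply/asboolP.
by apply: H; apply/eqP; case: (repr c).
Qed.

End MagnitudeHomology.

Record sset := SSet {
  simplex :> nat -> Type;
  face : forall n, 'I_n.+2 -> simplex n.+1 -> simplex n;
  degen : forall n, 'I_n.+1 -> simplex n -> simplex n.+1;
  face_face : forall n (i j : 'I_n.+2) (x : simplex n.+2), (i <= j)%N ->
    face i (face (lift ord0 j) x) = face j (face (widen_ord (leqnSn _) i) x);
  degen_degen : forall n (i j : 'I_n.+1) (x : simplex n), (i <= j)%N ->
    degen (widen_ord (leqnSn _) i) (degen j x) =
    degen (lift ord0 j) (degen i x);
  face_degen_lt : forall n (i : 'I_n.+2) (j : 'I_n.+1) (x : simplex n.+1),
    (i <= j)%N ->
    face (widen_ord (leqnSn _) i) (degen (lift ord0 j) x) = degen j (face i x);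
  face_degen_id : forall n (i : 'I_n.+1) (x : simplex n),
    face (widen_ord (leqnSn _) i) (degen i x) = x;
  face_degen_idS : forall n (i : 'I_n.+1) (x : simplex n),
    face (lift ord0 i) (degen i x) = x;
  face_degen_gt : forall n (i : 'I_n.+2) (j : 'I_n.+1) (x : simplex n.+1),
    (j < i)%N ->
    face (lift ord0 i) (degen (widen_ord (leqnSn _) j) x) = degen j (face i x)
}.

Section NerveSpace.
Variables (G : finDigraph) (l : nat).

Definition nv_simplex (n : nat) : Type :=
  {x : n.+1.-tuple G | (norm x <= (l%:Z)%:E)%E}.

Definition nv_face n (i : 'I_n.+2) (x : nv_simplex n.+1) : nv_simplex n :=
  exist _ (del i (sval x)) (le_trans (norm_del i (sval x)) (svalP x)).

Fact norm_dbl_le n (i : 'I_n.+1) (x : nv_simplex n) :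
  (norm (dbl i (sval x)) <= (l%:Z)%:E)%E.
Proof. by rewrite norm_dbl (svalP x). Qed.

Definition nv_degen n (i : 'I_n.+1) (x : nv_simplex n) : nv_simplex n.+1 :=
  exist _ (dbl i (sval x)) (norm_dbl_le i x).

Let nvP n (x y : nv_simplex n) :
  (forall k, tnth (sval x) k = tnth (sval y) k) -> x = y.
Proof. by move=> xy; apply: val_inj; apply: eq_from_tnth. Qed.

Ltac nv_simplicial := intros; apply: nvP => k /=; rewrite ?tnth_mktuple;
  congr tnth; apply: val_inj; rewrite /= /bump /unbump;
  repeat case: leqP => /= ?; lia.

Definition nerve_space : sset.
refine (@SSet nv_simplex nv_face nv_degen _ _ _ _ _ _).
all: abstract nv_simplicial.
Defined.

End NerveSpace.

Record category := Category {
  ob :> Type;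
  hom : ob -> ob -> Type;
  idm : forall x, hom x x;
  hcomp : forall x y z, hom y z -> hom x y -> hom x z;
  comp_idl : forall x y (f : hom x y), hcomp (idm y) f = f;
  comp_idr : forall x y (f : hom x y), hcomp f (idm x) = f;
  compA : forall x y z t (h : hom z t) (g : hom y z) (f : hom x y),
    hcomp h (hcomp g f) = hcomp (hcomp h g) f
}.

Definition thin (C : category) : Prop :=
  forall (x y : C) (f g : hom x y), f = g.

Section FundamentalCategory.
Variable X : sset.

(* A 1-simplex goes from its face opposite to vertex 1 to its face opposite to
   vertex 0. *)
Record edge (x y : X 0) := Edge {
  edge_val :> X 1;
  edge_src : face ord_max edge_val = x;
  edge_tgt : face ord0 edge_val = y
}.

Inductive qpath : X 0 -> X 0 -> Type :=
  | qnil x : qpath x x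
  | qcons x y z (f : edge x y) (p : qpath y z) : qpath x z.

Definition qedge x y (f : edge x y) : qpath x y := qcons f (qnil y).

Fixpoint qcat x y z (p : qpath x y) : qpath y z -> qpath x z :=
  match p with
  | qnil _ => id
  | qcons _ _ _ f p' => fun q => qcons f (qcat p' q)
  end.

Inductive qcong : forall x y, qpath x y -> qpath x y -> Prop :=
  | qcong_refl x y (p : qpath x y) : qcong p p
  | qcong_sym x y (p q : qpath x y) : qcong p q -> qcong q p
  | qcong_trans x y (p q r : qpath x y) : qcong p q -> qcong q r -> qcong p r
  | qcong_cat x y z (p p' : qpath x y) (q q' : qpath y z) :
      qcong p p' -> qcong q q' -> qcong (qcat p q) (qcat p' q')
  | qcong_triangle x y z (t : X 2) (f : edge x y) (g : edge y z) (h : edge x z) :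
      face ord_max t = f -> face ord0 t = g -> face (lift ord0 ord0) t = h ->
      qcong (qcat (qedge f) (qedge g)) (qedge h)
  | qcong_degen x (f : edge x x) : degen ord0 x = f -> qcong (qedge f) (qnil x).

Lemma qcat_nil x y (p : qpath x y) : qcat p (qnil y) = p.
Proof. by elim: p => //= x' y' z f p ->. Qed.

Lemma qcatA x y z t (p : qpath x y) (q : qpath y z) (r : qpath z t) :
  qcat p (qcat q r) = qcat (qcat p q) r.
Proof. by elim: p q r => //= x' y' z' f p IH q r; rewrite IH. Qed.

(* The boundary edges of a 2-simplex and of a degenerate 1-simplex, with their
   actual end points: each 2-simplex gives an instance of [qcong_triangle] and
   each 0-simplex an instance of [qcong_degen]. *)
Lemma edge_triangle (t : X 2) :
  exists x y z (f : edge x y) (g : edge y z) (h : edge x z),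
    [/\ face ord_max t = f, face ord0 t = g & face (lift ord0 ord0) t = h].
Proof.
have e0 : widen_ord (leqnSn 2) ord0 = ord0 by apply: val_inj.
have e1 : widen_ord (leqnSn 2) ord_max = lift ord0 ord0 by apply: val_inj.
have e2 : lift ord0 ord_max = ord_max :> 'I_3 by apply: val_inj.
have f00 := @face_face X 0 ord0 ord0 t isT; rewrite e0 in f00.
have f01 := @face_face X 0 ord0 ord_max t isT; rewrite e0 e2 in f01.
have f11 := @face_face X 0 ord_max ord_max t isT; rewrite e1 e2 in f11.
exists _, _, _, (Edge erefl f01), (Edge erefl (esym f00)), (Edge (esym f11) erefl).
by [].
Qed.

Lemma edge_degen (x : X 0) : exists f : edge x x, degen ord0 x = f.
Proof.
have e0 : widen_ord (leqnSn 1) ord0 = ord0 by apply: val_inj.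
have e1 : lift ord0 ord0 = ord_max :> 'I_2 by apply: val_inj.
have s := @face_degen_idS X 0 ord0 x; rewrite e1 in s.
have t := @face_degen_id X 0 ord0 x; rewrite e0 in t.
by exists (Edge s t).
Qed.

HB.instance Definition _ x y := gen_eqMixin (qpath x y).
HB.instance Definition _ x y := gen_choiceMixin (qpath x y).

Definition qequiv x y : rel (qpath x y) := fun p q => `[< qcong p q >].

Fact qequiv_refl x y : reflexive (@qequiv x y).
Proof. by move=> p; apply/asboolP/qcong_refl. Qed.
Fact qequiv_sym x y : symmetric (@qequiv x y).
Proof. by move=> p q; apply: asbool_equiv_eq; split; apply: qcong_sym. Qed.
Fact qequiv_trans x y : transitive (@qequiv x y).
Proof.
move=> q p r /asboolP pq /asboolP qr; apply/asboolP; exact: qcong_trans pq qr.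
Qed.

Canonical qequiv_rel x y :=
  EquivRel (@qequiv x y) (@qequiv_refl x y) (@qequiv_sym x y) (@qequiv_trans x y).

Local Open Scope quotient_scope.

Definition tau_hom (x y : X 0) : Type := {eq_quot (@qequiv_rel x y)}.

Definition tau_class x y (p : qpath x y) : tau_hom x y :=
  \pi_{eq_quot (@qequiv_rel x y)} p.
Definition tau_repr x y (f : tau_hom x y) : qpath x y :=
  repr (f : {eq_quot (@qequiv_rel x y)}).

Lemma tau_classP x y (p q : qpath x y) : tau_class p = tau_class q <-> qcong p q.
Proof.
split=> [/eqP|pq]; first by rewrite /tau_class eqmodE => /asboolP.
by apply/eqP; rewrite /tau_class eqmodE; apply/asboolP.
Qed.

Lemma tau_reprK x y (f : tau_hom x y) : tau_class (tau_repr f) = f.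
Proof. exact: reprK. Qed.

Definition tau_id (x : X 0) : tau_hom x x := tau_class (qnil x).

Definition tau_comp x y z (g : tau_hom y z) (f : tau_hom x y) : tau_hom x z :=
  tau_class (qcat (tau_repr f) (tau_repr g)).

Lemma tau_compE x y z (q : qpath y z) (p : qpath x y) :
  tau_comp (tau_class q) (tau_class p) = tau_class (qcat p q).
Proof.
by apply/tau_classP; apply: qcong_cat; apply/tau_classP; rewrite tau_reprK.
Qed.

Fact tau_idl x y (f : tau_hom x y) : tau_comp (tau_id y) f = f.
Proof. by rewrite -[f]tau_reprK tau_compE qcat_nil. Qed.

Fact tau_idr x y (f : tau_hom x y) : tau_comp f (tau_id x) = f.
Proof. by rewrite -[f]tau_reprK tau_compE. Qed.

Fact tau_compA x y z t (h : tau_hom z t) (g : tau_hom y z) (f : tau_hom x y) :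
  tau_comp h (tau_comp g f) = tau_comp (tau_comp h g) f.
Proof.
by rewrite -[h]tau_reprK -[g]tau_reprK -[f]tau_reprK !tau_compE qcatA.
Qed.

Definition tau : category :=
  @Category (X 0) tau_hom tau_id tau_comp tau_idl tau_idr tau_compA.

End FundamentalCategory.

Definition fundamental_category (l : nat) (G : finDigraph) : category :=
  tau (nerve_space G l).

(* Main.v *)
From mathcomp Require Import all_boot all_order all_algebra.
From mathcomp Require Import boolp constructive_ereal zify.
Require Import Defs.

(** Every edge of the quiver is a composite of arrows, because a shortest path
    from x to y of length at most l unfolds the edge (x,y) along 2-simplices.  So
    every morphism of the l-fundamental category is the morphism of a walk in
    the digraph ([mor_walk]), and two parallel walks of length at most l give
    the same morphism, namely the edge between their ends
    ([walks_agree_base]).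

    It remains to see that parallel walks give the same morphism whatever their
    lengths.  This goes by induction on a bound k >= l ([walks_agreeS]): suppose
    that parallel walks of length at most k agree.  Fix a morphism h from x to y
    and let A(a) be 1 if h factors through the vertex a as a composite of two
    walks of length at most k, and 0 otherwise; let B be 1 if h is itself a walk
    of length at most k, and 0 otherwise.  The function a |-> A(a) - B,
    evaluated at the middle vertex of the triples (x,a,y), is a 2-cocycle of the
    magnitude complex in degree k+1.  Indeed, by the induction hypothesis
    - A(a) = A(b) for every 4-tuple (x,a,b,y) of norm k+1, by associativity of
      the composition;
    - A(a) = B when d(x,a) + d(a,y) <= k, so that the faces (x,a,y) which the
      magnitude differential kills contribute nothing.

    As MH_{2,k+1} = 0, a cocycle vanishes on cycles.  If d(x,y) < k+1, each
    triple (x,a,y) of norm k+1 is a cycle, hence A(a) = B: a walk of length k+1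
    from x to y equals a shorter one.  If d(x,y) = k+1, the differences
    (x,a,y) - (x,b,y) are cycles, hence A(a) = A(b): a walk of length k+1 through
    a also factors through b.  In both cases the walks of length at most k+1
    from x to y agree. *)

Set Implicit Arguments.
Unset Strict Implicit.
Unset Printing Implicit Defensive.

Import Order.TTheory GRing.Theory Num.Theory.
Local Open Scope ring_scope.

(** * Triples and quadruples of vertices *)

Section Faces.
Variable G : finDigraph.
Implicit Types (x y a b : G).

Lemma dist_gt0 x y n : dist x y = (n%:Z)%:E -> x != y -> (0 < n)%N.
Proof.
move=> xy; rewrite lt0n; apply: contra => /eqP n0; apply/eqP/dist_eq0.
by rewrite xy n0.
Qed.

Lemma dist_neq x y n : dist x y = (n%:Z)%:E -> (0 < n)%N -> x != y.
Proof.
by move=> xy; apply: contraTneq => yx; move: xy; rewrite yx distxx => -[<-].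
Qed.

Lemma norm2 x y : norm [tuple x; y] = dist x y.
Proof. by rewrite /norm big_ord_recl big_ord0 adde0. Qed.

Lemma norm3 x a y : norm [tuple x; a; y] = (dist x a + dist a y)%E.
Proof. by rewrite /norm !big_ord_recl big_ord0 adde0. Qed.

Lemma norm4 x a b y :
  norm [tuple x; a; b; y] = (dist x a + (dist a b + dist b y))%E.
Proof. by rewrite /norm !big_ord_recl big_ord0 adde0. Qed.

Lemma reduced3 x a y : reduced [tuple x; a; y] = (x != a) && (a != y).
Proof.
apply/forallP/andP => [r|[xa ay] i].
  by have := r ord0; have := r ord_max; rewrite /tnth /= => -> ->.
by case: i => -[|[|//]] lt_i; rewrite /tnth.
Qed.

Lemma reduced4 x a b y :
  reduced [tuple x; a; b; y] = [&& x != a, a != b & b != y].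
Proof.
apply/forallP/and3P => [r|[xa ab b_y] i].
  have := r ord0; have := r ord_max; have := r (lift ord0 ord0).
  by rewrite /tnth /= => -> -> ->.
by case: i => -[|[|[|//]]] lt_i; rewrite /tnth.
Qed.

Lemma tuple3_eta (t : 3.-tuple G) : exists x a y, t = [tuple x; a; y].
Proof.
case: t => -[|x [|a [|y [|//]]]] //= s3.
by exists x, a, y; apply: val_inj.
Qed.

Lemma tuple4_eta (t : 4.-tuple G) : exists x a b y, t = [tuple x; a; b; y].
Proof.
case: t => -[|x [|a [|b [|y [|//]]]]] //= s4.
by exists x, a, b, y; apply: val_inj.
Qed.

Lemma del3E x a y :
  (del ord0 [tuple x; a; y] = [tuple a; y]) *
  (del (lift ord0 ord0) [tuple x; a; y] = [tuple x; y]) *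
  (del (lift ord0 (lift ord0 ord0)) [tuple x; a; y] = [tuple x; a]).
Proof.
by do !split; apply: eq_from_tnth => -[[|[|//]] i]; rewrite tnth_mktuple.
Qed.

Lemma del4E x a b y :
  (del ord0 [tuple x; a; b; y] = [tuple a; b; y]) *
  (del (lift ord0 ord0) [tuple x; a; b; y] = [tuple x; b; y]) *
  (del (lift ord0 (lift ord0 ord0)) [tuple x; a; b; y] = [tuple x; a; y]) *
  (del (lift ord0 (lift ord0 (lift ord0 ord0))) [tuple x; a; b; y] =
   [tuple x; a; b]).
Proof.
by do !split; apply: eq_from_tnth => -[[|[|[|//]]] i]; rewrite tnth_mktuple.
Qed.

Lemma add_dist_nat x a y k : (dist x a + dist a y)%E = (k%:Z)%:E ->
  exists m n, [/\ dist x a = (m%:Z)%:E, dist a y = (n%:Z)%:E & (m + n)%N = k].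
Proof.
case: (distP x a) => [m _ _|_]; case: (distP a y) => [n _ _|_] //.
by rewrite -EFinD -PoszD => -[mn]; exists m, n.
Qed.

Lemma add3_dist_nat x a b y k :
  (dist x a + (dist a b + dist b y))%E = (k%:Z)%:E ->
  exists m n p, [/\ dist x a = (m%:Z)%:E, dist a b = (n%:Z)%:E,
    dist b y = (p%:Z)%:E & (m + n + p)%N = k].
Proof.
case: (distP x a) => [m _ _|_]; case: (distP a b) => [n _ _|_] //;
  case: (distP b y) => [p _ _|_] //.
by rewrite -!EFinD -!PoszD addnA => -[mnp]; exists m, n, p.
Qed.
End Faces.

(** * Cocycles of the magnitude complex in degree 2 *)

Section Cochains.
Variables (G : finDigraph) (K : comNzRingType) (k : nat).

Definition pairing n (w : n.+1.-tuple G -> K) (c : MC G K n k) : K :=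
  \sum_s c s * w (val s).

Lemma pairing_basis n w (s : mc_gen G n k) :
  pairing w (mc_basis K s) = w (val s).
Proof.
rewrite /pairing (bigD1 s) //= ffunE eqxx mul1r big1 ?addr0 // => t ts.
by rewrite ffunE (negbTE ts) mul0r.
Qed.

Lemma pairingB n w (c d : MC G K n k) :
  pairing w (c - d) = pairing w c - pairing w d.
Proof.
by rewrite /pairing -sumrB; apply: eq_bigr => s _; rewrite !ffunE mulrBl.
Qed.

Lemma pairing_sum n w (I : finType) (a : I -> K) (c : I -> MC G K n k) :
  pairing w (\sum_i a i *: c i) = \sum_i a i * pairing w (c i).
Proof.
under [RHS]eq_bigr do rewrite mulr_sumr.
rewrite exchange_big; apply: eq_bigr => s _ /=.
rewrite sum_ffunE mulr_suml; apply: eq_bigr => i _.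
by rewrite ffunE mulrA.
Qed.

Lemma pairing_face n w (i : 'I_n.+2) (s : mc_gen G n.+1 k) :
  pairing w (mc_face K i s) =
  if norm (del i (val s)) == (k%:Z)%:E then w (del i (val s)) else 0.
Proof.
case: eqP => [dk|dk].
  by have [t tE ->] := mc_face_gen K dk; rewrite pairing_basis tE.
rewrite mc_face_eq0 // /pairing big1 // => t _.
by rewrite ffunE mul0r.
Qed.

Lemma pairing_diff n w (b : MC G K n.+1 k) :
  (forall s : mc_gen G n.+1 k, \sum_(i < n.+2) (-1) ^+ i *
    (if norm (del i (val s)) == (k%:Z)%:E then w (del i (val s)) else 0)
    = 0) ->
  pairing w (mc_diff b) = 0.
Proof.
move=> w0; rewrite /mc_diff pairing_sum big1 // => s _.
rewrite pairing_sum; under eq_bigr do rewrite pairing_face.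
by rewrite w0 mulr0.
Qed.

(** The cochains of interest see only the triples from x to y, and depend on
    their middle vertex.  [W_eq] is the cocycle condition on the quadruples both
    of whose inner faces keep the norm k; by [W_0], a face whose norm drops
    may be kept in the differential all the same. *)
Variables (x y : G) (W : G -> K).
Hypothesis MH0 : forall c : MH G K 2 k, c = 0.
Hypothesis W_eq : forall a b m n p,
  dist x a = (m%:Z)%:E -> dist a b = (n%:Z)%:E -> dist b y = (p%:Z)%:E ->
  (0 < m)%N -> (0 < n)%N -> (0 < p)%N -> (m + n + p)%N = k -> W a = W b.
Hypothesis W_0 : forall a m n,
  dist x a = (m%:Z)%:E -> dist a y = (n%:Z)%:E -> (m + n < k)%N -> W a = 0.

Definition mid_cochain (t : 3.-tuple G) : K :=
  if (tnth t ord0 == x) && (tnth t ord_max == y)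
  then W (tnth t (lift ord0 ord0)) else 0.

Lemma mid_cochainE x' a y' : mid_cochain [tuple x'; a; y'] =
  if (x' == x) && (y' == y) then W a else 0.
Proof. by []. Qed.

Lemma mid_cochain_face (t : 3.-tuple G) : (norm t <= (k%:Z)%:E)%E ->
  (if norm t == (k%:Z)%:E then mid_cochain t else 0) = mid_cochain t.
Proof.
have [x' [a [y' ->]]] := tuple3_eta t.
case: (norm _ =P _) => // neq le; rewrite mid_cochainE.
case: (@andP (x' == x) (y' == y)) => // -[/eqP xE /eqP yE]; apply/esym.
move: neq le; rewrite norm3 xE yE.
case xa: (dist x a) / distP => [m _ _|_]; last by case: (distP a y).
case ay: (dist a y) / distP => [n _ _|_] //.
rewrite -EFinD lee_fin -PoszD lez_nat => neq le; apply: (W_0 xa ay).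
by rewrite ltn_neqAle le andbT; apply: contra_not_neq neq => ->.
Qed.

(** The outer faces of a quadruple of norm k have smaller norm, as distinct
    vertices are at positive distance; the two inner ones have opposite signs and
    equal values. *)
Lemma mid_cochain_cocycle (b : MC G K 3 k) :
  pairing mid_cochain (mc_diff b) = 0.
Proof.
apply: pairing_diff => -[t /=]; have [x' [a [c [y' ->]]]] := tuple4_eta t.
rewrite reduced4 norm4 => /andP[/and3P[xa ac cy] /eqP tk].
have [m [n [p [xam acn cyp mnp]]]] := add3_dist_nat tk.
have m0 := dist_gt0 xam xa; have n0 := dist_gt0 acn ac.
have p0 := dist_gt0 cyp cy.
rewrite !big_ord_recl big_ord0 !del4E.
rewrite (@mid_cochain_face [tuple x'; c; y']); last first.
  by rewrite norm3 -tk addeA leeD // dist_triangle.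
rewrite (@mid_cochain_face [tuple x'; a; y']); last first.
  by rewrite norm3 -tk leeD // dist_triangle.
rewrite !norm3 xam acn cyp -!EFinD -!PoszD ifF; last first.
  by apply/eqP => -[]; lia.
rewrite ifF; last by apply/eqP => -[]; lia.
rewrite !mulr0 add0r !addr0 /= /bump /= expr1 sqrrN expr1n mulN1r mul1r.
rewrite !mid_cochainE.
case: (@andP (x' == x) (y' == y)) => [[/eqP xE /eqP yE]|_]; last first.
  by rewrite oppr0 addr0.
rewrite xE in xam; rewrite yE in cyp.
by rewrite (W_eq xam acn cyp) // addrC subrr.
Qed.

Lemma mid_cochain_cycle (z : MC G K 2 k) :
  mc_bd z = 0 -> pairing mid_cochain z = 0.
Proof.
case: (mh_eq0 G K 2 k) => /(_ MH0) + _ => /[apply] -[b <-].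
exact: mid_cochain_cocycle.
Qed.

Lemma between_gen a m n :
  dist x a = (m%:Z)%:E -> dist a y = (n%:Z)%:E -> (0 < m)%N -> (0 < n)%N ->
  (m + n)%N = k -> exists s : mc_gen G 2 k, val s = [tuple x; a; y].
Proof.
move=> xa ay m0 n0 mnk.
have P : reduced [tuple x; a; y] && (norm [tuple x; a; y] == (k%:Z)%:E).
  rewrite reduced3 (dist_neq xa) // (dist_neq ay) //.
  by rewrite norm3 xa ay -EFinD -PoszD mnk eqxx.
by exists (Sub [tuple x; a; y] P : mc_gen G 2 k); rewrite SubK.
Qed.

(** The result depends on the ends of the triple only, whence the cycles below:
    differences of triples with common ends, and single triples whose ends are
    not at distance k. *)
Lemma bd_between (s : mc_gen G 2 k) x' a y' : val s = [tuple x'; a; y'] ->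
  mc_bd (mc_basis K s) = - mc_tuple K k [tuple x'; y'].
Proof.
move=> sE /=; rewrite mc_diff_basis.
have /andP[] := valP s; rewrite sE reduced3 norm3 => /andP[xa ay] /eqP xay.
have [m [n [xam ayn mn]]] := add_dist_nat xay.
have m0 := dist_gt0 xam xa; have n0 := dist_gt0 ayn ay.
rewrite !big_ord_recl big_ord0 [mc_face K ord0 s]mc_face_eq0; last first.
  by rewrite sE del3E norm2 ayn => -[]; lia.
rewrite [mc_face K (lift ord0 (lift _ _)) s]mc_face_eq0; last first.
  by rewrite sE del3E norm2 xam => -[]; lia.
by rewrite /mc_face sE del3E !scaler0 add0r !addr0 /bump /= expr1 scaleN1r.
Qed.

Lemma cocycle_eq0 a m n : dist x y <> (k%:Z)%:E ->
  dist x a = (m%:Z)%:E -> dist a y = (n%:Z)%:E -> (0 < m)%N -> (0 < n)%N ->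
  (m + n)%N = k -> W a = 0.
Proof.
move=> xyk xa ay m0 n0 mn; have [s sE] := between_gen xa ay m0 n0 mn.
have := @mid_cochain_cycle (mc_basis K s).
rewrite pairing_basis sE mid_cochainE !eqxx.
apply; rewrite (bd_between sE) /mc_tuple.
case: insubP => [u /andP[_]|_]; last by rewrite oppr0.
by rewrite norm2 => /eqP.
Qed.

Lemma cocycle_const a m n a' m' n' :
  dist x a = (m%:Z)%:E -> dist a y = (n%:Z)%:E -> (0 < m)%N -> (0 < n)%N ->
  (m + n)%N = k ->
  dist x a' = (m'%:Z)%:E -> dist a' y = (n'%:Z)%:E ->
  (0 < m')%N -> (0 < n')%N -> (m' + n')%N = k -> W a = W a'.
Proof.
move=> xa ay m0 n0 mn xa' ay' m0' n0' mn'.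
have [s sE] := between_gen xa ay m0 n0 mn.
have [s' sE'] := between_gen xa' ay' m0' n0' mn'.
have := @mid_cochain_cycle (mc_basis K s - mc_basis K s').
rewrite pairingB !pairing_basis sE sE' !mid_cochainE !eqxx => H; apply/eqP.
rewrite -subr_eq0; apply/eqP; apply: H.
rewrite linearB /=.
by rewrite [X in X - _](bd_between sE) [X in _ - X](bd_between sE') subrr.
Qed.
End Cochains.

(** * Morphisms of walks in a category on the vertices of a digraph *)

Section Walks.
(** The objects of C correspond to the vertices of G by [v] and [o].  A bijection,
    rather than an equality of types, because the objects of the fundamental
    category are 0-simplices, that is, 1-tuples with a bound on their norm. *)
Variables (G : finDigraph) (C : category) (v : C -> G) (o : G -> C).
Hypotheses (vK : cancel v o) (oK : cancel o v).
Variable e : forall x a : C, arrow (v x) (v a) -> hom x a.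

Inductive walk_mor (y : C) : nat -> forall x, hom x y -> Prop :=
| walk_mor0 : walk_mor 0 (idm y)
| walk_morS n x a (w : arrow (v x) (v a)) (g : hom a y) :
    walk_mor n g -> walk_mor n.+1 (hcomp g (e w)).

Lemma walk_mor_inv (y x : C) n (f : hom x y) : walk_mor n.+1 f ->
  exists a (w : arrow (v x) (v a)) (g : hom a y),
    walk_mor n g /\ f = hcomp g (e w).
Proof.
move=> fn.
(* The conclusion, stated for all the indices of the inductive family. *)
pose ends m x' (h : hom x' y) : Prop := if m is m'.+1 then
  exists a (w : arrow (v x') (v a)) (g : hom a y),
    walk_mor m' g /\ h = hcomp g (e w) else True.
have : ends n.+1 x f by case: fn => [|m x' a w g gm] //=; exists a, w, g.
by [].
Qed.

Lemma walk_mor_comp (x y z : C) m n (f : hom x y) (g : hom y z) :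
  walk_mor m f -> walk_mor n g -> walk_mor (m + n) (hcomp g f).
Proof.
move=> hf hg; elim: hf => [|p x' a w f' _ IH]; first by rewrite comp_idr.
by rewrite compA addSn; apply: walk_morS.
Qed.

Lemma walk_mor1 (x a : C) (w : arrow (v x) (v a)) : walk_mor 1 (e w).
Proof. by rewrite -[e w]comp_idl; apply/walk_morS/walk_mor0. Qed.

Lemma walk_mor_walk (x y : C) n (f : hom x y) :
  walk_mor n f -> walk n (v x) (v y).
Proof.
elim=> [|p x' a w g _ /walkP[q [sq aq lq]]]; apply/walkP; first by exists [::].
by exists (v a :: q); rewrite /= sq w.
Qed.

Lemma walk_walk_mor (x y : C) n : walk n (v x) (v y) ->
  exists f : hom x y, walk_mor n f.
Proof.
case/walkP => q [<- {n}]; elim: q x => [|a q IH] x /=.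
  by move=> _ /(can_inj vK) ->; exists (idm y); apply: walk_mor0.
case/andP => xa aq lq; have [||f hf] := IH (o a); rewrite ?oK //.
have w : arrow (v x) (v (o a)) by rewrite oK.
by exists (hcomp f (e w)); apply: walk_morS.
Qed.

Lemma geodesic (x y : C) n : dist (v x) (v y) = (n%:Z)%:E ->
  exists f : hom x y, walk_mor n f.
Proof. by case: distP => // m w _ [<-]; apply: walk_walk_mor. Qed.

Definition walks_agree k := forall (x y : C) m n (f g : hom x y),
  (m <= k)%N -> (n <= k)%N -> walk_mor m f -> walk_mor n g -> f = g.

Definition short k (x y : C) (h : hom x y) :=
  exists2 m, (m <= k)%N & walk_mor m h.

Definition short_via k (x y a : C) (h : hom x y) :=
  exists (f : hom x a) (g : hom a y), [/\ short k f, short k g & h = hcomp g f].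

Lemma short_agree k (x y : C) (f g : hom x y) :
  walks_agree k -> short k f -> short k g -> f = g.
Proof. by move=> agr [m mk fm] [n nk gn]; apply: agr fm gn. Qed.

(** The walks behind f and g need not be shortest, and their lengths may add up
    to more than k; they are traded for geodesics first. *)
Lemma short_comp k m n (x a y : C) (f : hom x a) (g : hom a y) :
  walks_agree k ->
  dist (v x) (v a) = (m%:Z)%:E -> dist (v a) (v y) = (n%:Z)%:E ->
  (m + n <= k)%N -> short k f -> short k g -> short k (hcomp g f).
Proof.
move=> agr /geodesic[f' hf'] /geodesic[g' hg'] mn sf sg.
have -> : f = f' by apply: (short_agree agr sf); exists m => //; lia.
have -> : g = g' by apply: (short_agree agr sg); exists n => //; lia.
by exists (m + n)%N => //; apply: walk_mor_comp.
Qed.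

Lemma short_geodesic k m (x a : C) : (m <= k)%N ->
  dist (v x) (v a) = (m%:Z)%:E -> exists f : hom x a, short k f.
Proof. by move=> mk /geodesic[f hf]; exists f, m. Qed.

(** Associativity: with u a geodesic from a to b, a second factor from a to y is
    a composite g' u with g' from b, and a first factor from x to b is a
    composite u f' with f' to a.  All the walks involved have length at most k
    because m, n and p are positive. *)
Lemma short_via_shift k m n p (x a b y : C) (h : hom x y) : walks_agree k ->
  dist (v x) (v a) = (m%:Z)%:E -> dist (v a) (v b) = (n%:Z)%:E ->
  dist (v b) (v y) = (p%:Z)%:E -> (0 < m)%N -> (0 < n)%N -> (0 < p)%N ->
  (m + n + p)%N = k.+1 -> short_via k a h <-> short_via k b h.
Proof.
move=> agr xa ab b_y m0 n0 p0 mnp.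
have [||u su] := @short_geodesic k n a b => //; first lia.
split=> -[f [g [sf sg ->]]].
  have [||g' sg'] := @short_geodesic k p b y => //; first lia.
  have -> : g = hcomp g' u.
    by apply: (short_agree agr sg); apply: (short_comp agr ab b_y) => //; lia.
  rewrite -compA; exists (hcomp u f), g'; split=> //.
  by apply: (short_comp agr xa ab) => //; lia.
have [||f' sf'] := @short_geodesic k m x a => //; first lia.
have -> : f = hcomp u f'.
  by apply: (short_agree agr sf); apply: (short_comp agr xa ab) => //; lia.
rewrite compA; exists f', (hcomp g u); split=> //.
by apply: (short_comp agr ab b_y) => //; lia.
Qed.

Lemma short_via_short k m n (x a y : C) (h : hom x y) : walks_agree k ->
  dist (v x) (v a) = (m%:Z)%:E -> dist (v a) (v y) = (n%:Z)%:E ->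
  (m + n <= k)%N -> short_via k a h <-> short k h.
Proof.
move=> agr xa ay mn; split=> [[f [g [sf sg ->]]]|sh].
  exact: (short_comp agr xa ay).
have [||f sf] := @short_geodesic k m x a => //; first lia.
have [||g sg] := @short_geodesic k n a y => //; first lia.
exists f, g; split=> //; apply: (short_agree agr sh).
exact: (short_comp agr xa ay).
Qed.

Variable K : comNzRingType.

(** If h itself is a short walk, the vertices a for which d(x,a) + d(a,y) is small
    let h factor; subtracting the second term makes the cochain vanish there, as
    [W_0] requires. *)
Definition via_cochain k (x y : C) (h : hom x y) (a : G) : K :=
  `[< short_via k (o a) h >]%:R - `[< short k h >]%:R.

Lemma via_cochain_shift k (x y : C) (h : hom x y) a b m n p : walks_agree k ->
  dist (v x) a = (m%:Z)%:E -> dist a b = (n%:Z)%:E ->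
  dist b (v y) = (p%:Z)%:E ->
  (0 < m)%N -> (0 < n)%N -> (0 < p)%N -> (m + n + p)%N = k.+1 ->
  via_cochain k h a = via_cochain k h b.
Proof.
move=> agr xa ab b_y m0 n0 p0 mnp; rewrite /via_cochain.
congr ((nat_of_bool _)%:R - _).
by apply: asbool_equiv_eq; apply: (@short_via_shift k m n p); rewrite ?oK.
Qed.

Lemma via_cochain_short k (x y : C) (h : hom x y) a m n : walks_agree k ->
  dist (v x) a = (m%:Z)%:E -> dist a (v y) = (n%:Z)%:E -> (m + n < k.+1)%N ->
  via_cochain k h a = 0.
Proof.
move=> agr xa ay mn; apply/eqP; rewrite subr_eq0; apply/eqP.
congr (nat_of_bool _)%:R.
by apply: asbool_equiv_eq; apply: (@short_via_short k m n); rewrite ?oK.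
Qed.

(** The first arrow of a walk of length k+1 ends at a; if d(a,y) < k then the
    rest of the walk can be replaced by a shorter one. *)
Lemma long_walk_split k (x y : C) (f : hom x y) : (0 < k)%N -> walks_agree k ->
  short k.+1 f -> short k f \/
  exists a, [/\ short_via k a f, dist (v x) (v a) = 1%:E &
    dist (v a) (v y) = (k%:Z)%:E].
Proof.
move=> k0 agr [m].
rewrite leq_eqVlt => /orP[/eqP->|mk fm]; last by left; exists m.
case/walk_mor_inv=> a [w [g [gk ->]]].
have sg : short k g by exists k.
have se : short k (e w) by exists 1%N => //; apply: walk_mor1.
have xa : dist (v x) (v a) = 1%:E.
  have := dist_walk (walk_mor_walk (walk_mor1 w)).
  case: distP (@dist_gt0 G (v x) (v a)) => // n _ _ /(_ _ erefl) n0.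
  rewrite lee_fin lez_nat => n1; suff -> : n = 1%N by [].
  suff : (0 < n)%N by lia.
  by apply: n0; apply: contraTneq (w) => ->; rewrite arrow_irr.
have := dist_walk (walk_mor_walk gk).
case E: (dist (v a) (v y)) / distP => [n _ _|_] //.
rewrite lee_fin lez_nat leq_eqVlt => /orP[/eqP nk|nk].
  by right; exists a; split=> //; [exists (e w), g | rewrite E nk].
by left; apply: (@short_comp k 1 n) => //; rewrite -E.
Qed.

(** The induction step.  The morphism that the cocycle tests is one of the two
    walks f and g to be compared. *)
Lemma walks_agreeS k : (0 < k)%N -> (forall c : MH G K 2 k.+1, c = 0) ->
  walks_agree k -> walks_agree k.+1.
Proof.
move=> k0 MH0 agr x y m n f g mk nk fm gn.
have sf : short k.+1 f by exists m.
have sg : short k.+1 g by exists n.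
have Weq h a b m' n' p' := @via_cochain_shift k x y h a b m' n' p' agr.
have W0 h a m' n' := @via_cochain_short k x y h a m' n' agr.
have [xyk|xyk] := pselect (dist (v x) (v y) = (k.+1%:Z)%:E).
  have nshort h : ~ @short k x y h.
    move=> [p pk /walk_mor_walk/dist_walk].
    by rewrite xyk lee_fin lez_nat; lia.
  (* Both walks are long, through a and b; f then also factors through b. *)
  case: (long_walk_split k0 agr sf) => [/nshort//|[a [fa xa ay]]].
  case: (long_walk_split k0 agr sg) => [/nshort//|[b [gb xb b_y]]].
  have := @cocycle_const G K k.+1 (v x) (v y) (via_cochain k f) MH0
    (Weq f) (W0 f) (v a) 1 k (v b) 1 k xa ay isT k0 erefl xb b_y isT k0 erefl.
  rewrite /via_cochain !vK (asboolT fa) => /addIr.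
  case: asboolP => [fb _|_ /eqP]; last by rewrite oner_eq0.
  case: fb gb => f1 [f2 [sf1 sf2 ->]] [g1 [g2 [sg1 sg2 ->]]].
  by rewrite (short_agree agr sf1 sg1) (short_agree agr sf2 sg2).
(* Here x and y are at distance at most k, and long walks become short. *)
suff sh h : @short k.+1 x y h -> short k h.
  by apply: (short_agree agr); apply: sh.
move=> hk; case: (long_walk_split k0 agr hk) => // -[a [ha xa ay]].
have := @cocycle_eq0 G K k.+1 (v x) (v y) (via_cochain k h) MH0
    (Weq h) (W0 h) (v a) 1 k xyk xa ay isT k0 erefl.
rewrite /via_cochain !vK (asboolT ha).
by case: asboolP => // _; rewrite subr0 => /eqP; rewrite oner_eq0.
Qed.

Lemma walks_agree_all l : (0 < l)%N ->
  (forall k, (l < k)%N -> forall c : MH G K 2 k, c = 0) -> walks_agree l ->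
  forall k, (l <= k)%N -> walks_agree k.
Proof.
move=> l0 MH0 agr k lk; rewrite -(subnKC lk).
elim: (k - l)%N => [|n IH]; first by rewrite addn0.
by rewrite addnS; apply: walks_agreeS => //; [lia | apply: MH0; lia].
Qed.
End Walks.

(** * The fundamental category *)

Section Fundamental.
Variables (G : finDigraph) (l : nat).
Notation X := (nerve_space G l).

Definition pt (x : X 0%N) : G := tnth (sval x) ord0.

Fact norm_pt (a : G) : (norm [tuple a] <= (l%:Z)%:E)%E.
Proof. by rewrite /norm big_ord0 lee_fin. Qed.
Definition of_pt (a : G) : X 0%N := exist _ [tuple a] (norm_pt a).

Lemma of_ptK : cancel of_pt pt.
Proof. by []. Qed.

Lemma ptK : cancel pt of_pt.
Proof.
move=> x; apply: val_inj; apply: eq_from_tnth => i /=; rewrite (ord1 i) /pt.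
by case: x.
Qed.

Fact norm_edge (x y : X 0%N) : (dist (pt x) (pt y) <= (l%:Z)%:E)%E ->
  (norm [tuple pt x; pt y] <= (l%:Z)%:E)%E.
Proof. by rewrite norm2. Qed.

Lemma pt_inj : injective pt. Proof. exact: can_inj ptK. Qed.

Lemma simplex_eq n (s t : X n) :
  (forall i, tnth (sval s) i = tnth (sval t) i) -> s = t.
Proof. by move=> st; apply: val_inj; apply: eq_from_tnth. Qed.

Definition nv_edge (x y : X 0%N) (d : (dist (pt x) (pt y) <= (l%:Z)%:E)%E) :
  edge x y.
Proof.
refine (@Edge X x y (exist _ [tuple pt x; pt y] (norm_edge d)) _ _).
all: abstract (apply: pt_inj; rewrite /pt /= tnth_mktuple (tnth_nth (pt x))
  //= (tnth_nth (pt x))).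
Defined.

Lemma edge_eq (x y : X 0%N) (f g : edge x y) : edge_val f = edge_val g -> f = g.
Proof.
case: f g => f fs ft [g gs gt] /= fg; rewrite fg in fs ft *.
by congr Edge; apply: Prop_irrelevance.
Qed.

Lemma edgeE (x y : X 0%N) (f : edge x y) :
  exists d : (dist (pt x) (pt y) <= (l%:Z)%:E)%E, f = nv_edge d.
Proof.
have fE : sval (edge_val f) = [tuple pt x; pt y].
  case: f => [[t tl] /= <- <-]; apply: eq_from_tnth => -[[|[|//]] i];
    rewrite /pt /= [RHS](tnth_nth (tnth t ord0)) /= tnth_mktuple;
    by congr tnth; apply: val_inj.
have d : (dist (pt x) (pt y) <= (l%:Z)%:E)%E.
  by rewrite -norm2 -fE; case: (edge_val f).
by exists d; apply: edge_eq; apply: val_inj.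
Qed.

Notation T := (fundamental_category l G).

Definition nv_mor (x y : T) (d : (dist (pt x) (pt y) <= (l%:Z)%:E)%E) :
  hom x y := tau_class (qedge (nv_edge d)).

Lemma nv_mor_comp (x y z : T) (dxy : (dist (pt x) (pt y) <= (l%:Z)%:E)%E)
  (dyz : (dist (pt y) (pt z) <= (l%:Z)%:E)%E)
  (dxz : (dist (pt x) (pt z) <= (l%:Z)%:E)%E) :
  (dist (pt x) (pt y) + dist (pt y) (pt z) <= (l%:Z)%:E)%E ->
  hcomp (nv_mor dyz) (nv_mor dxy) = nv_mor dxz.
Proof.
move=> d3; rewrite /nv_mor [LHS]tau_compE; apply/tau_classP.
have t3 : (norm [tuple pt x; pt y; pt z] <= (l%:Z)%:E)%E by rewrite norm3.
apply: (@qcong_triangle X x y z (exist _ [tuple pt x; pt y; pt z] t3));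
  apply: simplex_eq => -[[|[|//]] i]; rewrite /= tnth_mktuple;
  by rewrite !(tnth_nth (pt x)).
Qed.

Lemma nv_mor_id (x : T) (d : (dist (pt x) (pt x) <= (l%:Z)%:E)%E) :
  nv_mor d = idm x.
Proof.
apply/tau_classP; apply: qcong_degen; apply: simplex_eq => -[[|[|//]] i];
  rewrite /= tnth_mktuple [RHS](tnth_nth (pt x)) /= /pt;
  by congr tnth; apply: val_inj.
Qed.

Hypothesis l0 : (0 < l)%N.

Fact arrow_dist (a b : G) : arrow a b -> (dist a b <= (l%:Z)%:E)%E.
Proof.
move=> ab; apply: (@le_trans _ _ 1%:E); last by rewrite lee_fin lez_nat.
by apply: (@dist_walk _ 1); apply/walkP; exists [:: b]; rewrite /= ab.
Qed.

Definition arrow_mor (x y : T) (w : arrow (pt x) (pt y)) : hom x y :=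
  nv_mor (arrow_dist w).

(** A walk of length at most l collapses, one 2-simplex at a time, to the edge
    between its ends. *)
Lemma walk_mor_nv (x y : T) n (f : hom x y) : (n <= l)%N ->
  walk_mor arrow_mor n f -> forall d, f = nv_mor d.
Proof.
move=> nl fn.
elim: fn nl => [_|m x' a w g gm IH ml] d; first by rewrite nv_mor_id.
have dm : (dist (pt a) (pt y) <= (m%:Z)%:E)%E.
  exact/dist_walk/(walk_mor_walk gm).
have dl : (dist (pt a) (pt y) <= (l%:Z)%:E)%E.
  by apply: le_trans dm _; rewrite lee_fin lez_nat ltnW.
rewrite (IH (ltnW ml) dl); apply: nv_mor_comp.
apply: (@le_trans _ _ (1%:E + (m%:Z)%:E)%E); last first.
  by rewrite -EFinD lee_fin -PoszD lez_nat.
apply: leeD => //; apply: (@dist_walk _ 1).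
by apply/walkP; exists [:: pt a]; rewrite /= w.
Qed.

Lemma walks_agree_base : walks_agree arrow_mor l.
Proof.
move=> x y m n f g ml nl fm gn.
have d : (dist (pt x) (pt y) <= (l%:Z)%:E)%E.
  apply: le_trans (dist_walk (walk_mor_walk fm)) _.
  by rewrite lee_fin lez_nat.
by rewrite (walk_mor_nv ml fm d) (walk_mor_nv nl gn d).
Qed.

Lemma nv_mor_walk (x y : T) (d : (dist (pt x) (pt y) <= (l%:Z)%:E)%E) :
  exists n, walk_mor arrow_mor n (nv_mor d).
Proof.
have [n xy nl] : exists2 n, walk n (pt x) (pt y) & (n <= l)%N.
  by case: distP d => // n xy _; rewrite lee_fin lez_nat; exists n.
have [f fn] := @walk_walk_mor G T pt of_pt ptK of_ptK arrow_mor x y n xy.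
by exists n; rewrite -(walk_mor_nv nl fn d).
Qed.

Lemma mor_walk (x y : T) (f : hom x y) : exists n, walk_mor arrow_mor n f.
Proof.
rewrite -[f]tau_reprK; elim: (tau_repr f) => {x y f} [x|x y z f p [n pn]].
  by exists 0%N; apply: walk_mor0.
have [d ->] := edgeE f; have [m fm] := nv_mor_walk d.
exists (m + n)%N; have -> : tau_class (qcons (nv_edge d) p) =
  hcomp (tau_class p : @hom T y z) (nv_mor d) by rewrite [RHS]tau_compE.
exact: walk_mor_comp.
Qed.
End Fundamental.

Theorem proposition4p16 (K : comNzRingType) (G : finDigraph) (l : nat)
  (hl : (1 <= l)%N)
  (hMH : forall k : nat, (l < k)%N -> forall c : MH G K 2 k, c = 0) :
  thin (fundamental_category l G).
Proof.
move=> x y f g; have [m fm] := mor_walk hl f; have [n gn] := mor_walk hl g.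
have agr : walks_agree (@arrow_mor G l hl) (l + maxn m n).
  exact: (@walks_agree_all G (fundamental_category l G) _ _ (@ptK G l)
    (@of_ptK G l) (arrow_mor hl) K l hl hMH (@walks_agree_base G l hl)
    _ (leq_addr _ _)).
by apply: agr fm gn; lia.
Qed.
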